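(* Let $f:\mathbb{R}^n\to\mathbb{R}$ be convex and differentiable, with nonempty solution set $\Omega=\arg\min_{x} f(x)$ and optimal value $f^*=\min_x f(x)$. Assume that there are constants $L_1,\dots,L_n>0$ such that for each $i=1,\dots,n$, $$|\nabla_i f(x)-\nabla_i f(x+he_i)|\le L_i|h|\qquad\text{for all }x\in\mathbb{R}^n,\ h\in\mathbb{R}.$$ Let $\bar L_1,\dots,\bar L_n$ satisfy $\bar L_i\ge L_i$ for all $i$, and let $p_1,\dots,p_n$ satisfy $\sum_{i=1}^n p_i=1$ and $p_i\ge p_{\min}$ for all $i$, for some constant $p_{\min}>0$. Let $x_0\in\mathbb{R}^n$ be arbitrary (deterministic) and let $$x_{k+1}=x_k-\frac{\nabla_{i_k}f(x_k)}{\bar L_{i_k}}e_{i_k},\qquad k=0,1,2,\dots,$$ where $i_0,i_1,i_2,\dots$ are independent random indices in $\{1,\dots,n\}$, each with $\Pr(i_k=i)=p_i$. Then $\mathbb{E}_{i_0,\dots,i_{k-1}}[f(x_k)]$ converges to $f^*$ at rate $o(1/k)$, that is, $\lim_{k\to\infty}k\left(\mathbb{E}_{i_0,\dots,i_{k-1}}[f(x_k)]-f^*\right)=0$.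
   Context: Here $e_i$ is the $i$th standard unit vector of $\mathbb{R}^n$, and $\nabla_i f(x)$ is the $i$th coordinate of the gradient $\nabla f(x)$. *)

(* Defs.v *)
From HB Require Import structures.
From mathcomp Require Import all_boot all_order all_algebra finmap.
From mathcomp Require Import all_classical all_reals all_analysis.
Set Implicit Arguments.
Unset Strict Implicit.
Unset Printing Implicit Defensive.
Import Order.TTheory GRing.Theory Num.Theory.
Import numFieldNormedType.Exports.
Local Open Scope classical_set_scope.
Local Open Scope ring_scope.

Section Optimization.
Variables (R : realType) (n : nat).
Implicit Type f : 'rV[R]_n -> R.

Definition unit_vec (i : 'I_n) : 'rV[R]_n := delta_mx 0 i.

(* The library norm on ['rV[R]_n] is the sup norm; being finite-dimensional,
   the space has the same differentiable functions as for the Euclidean norm. *)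
Definition gradient f (x : 'rV[R]_n) : 'rV[R]_n :=
  \row_i 'D_(unit_vec i) (f : 'rV[R]_n -> R^o) x.

Definition argmin f : set 'rV[R]_n := [set x | forall y, f x <= f y].

Definition is_min_value f (m : R) : Prop := range f m /\ lbound (range f) m.

(* [coord_descent f Lbar x0 i k] depends on [i] only through [i 0, ..., i k.-1]. *)
Fixpoint coord_descent f (Lbar : 'I_n -> R) (x0 : 'rV[R]_n)
    (i : nat -> 'I_n) (k : nat) : 'rV[R]_n :=
  if k is k'.+1 then
    let x := coord_descent f Lbar x0 i k' in
    x - (gradient f x 0 (i k') / Lbar (i k')) *: unit_vec (i k')
  else x0.

End Optimization.

Section FiniteValuedRandomVariables.
Variables (d : measure_display) (T : measurableType d) (R : realType).
Variable S : finType.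

(* Measurability for the discrete sigma-algebra on [S]; the library's
   measurable types are pointed, which excludes ['I_n] for a general [n]. *)
Definition finite_rv (X : T -> S) : Prop :=
  forall A : set S, measurable (X @^-1` A).

Definition mutually_independent (P : probability T R) (X : nat -> T -> S) :
    Prop :=
  forall (J : {fset nat}) (A : nat -> set S),
    P (\bigcap_(k in [set` J]) (X k @^-1` A k)) =
    (\prod_(k <- J) P (X k @^-1` A k))%E.

End FiniteValuedRandomVariables.

(* Main.v *)
(* Averaging over the next index turns the iteration into a monotone, affine
   operator Q on functions of the current point, and by independence
   E[F(x_k)] = (Q^k F)(x0). The squared distance to a minimizer xs, weighted by
   Lbar_j / p_j, plus (2 / pmin) (f - f xs), decreases under Q by at least
   2 (f - f xs): the second-order term of the distance is paid for by the
   descent of f along the chosen coordinate. Hence the nonincreasing sequence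
   a_k = E[f(x_k)] - f xs satisfies 2 a_k <= b_k - b_(k+1) with b_k >= 0, and
   k a_k <= b_(k/2) - b_k -> 0. *)
Require Import Defs.
From HB Require Import structures.
From mathcomp Require Import all_boot all_order all_algebra finmap.
From mathcomp Require Import all_classical all_reals all_analysis.
From mathcomp Require Import ring lra.
Import Order.TTheory GRing.Theory Num.Theory.
Import numFieldNormedType.Exports.
Local Open Scope classical_set_scope.
Local Open Scope ring_scope.

Set Implicit Arguments.
Unset Strict Implicit.
Unset Printing Implicit Defensive.

(** * Decay rate of monotone summable sequences *)

Lemma telescoping_rate (R : realType) (a b : R^nat) :
  (forall k, 0 <= a k) -> (forall k, a k.+1 <= a k) -> (forall k, 0 <= b k) ->
  (forall k, b k.+1 <= b k - 2 * a k) ->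
  k%:R * a k @[k --> \oo] --> (0 : R).
Proof.
move=> a0 adecr b0 bdecr.
(* The decrements of [b] telescope over the block, and each [a l] in it is at least the last term
   [a (m + r)]. *)
have blk m r : r%:R * (2 * a (m + r)%N) <= b m - b (m + r)%N.
  elim: r => [|r IH]; first by rewrite mul0r addn0 subrr.
  rewrite addnS mulrSr mulrDl mul1r.
  have := bdecr (m + r)%N; have := adecr (m + r)%N.
  have := ler_wpM2l (ler0n R r) (adecr (m + r)%N); move: IH; lra.
have bcvg : cvgn b.
  apply: nonincreasing_is_cvgn; last by exists 0 => _ [k _ <-].
  apply/nonincreasing_seqP => k; apply: le_trans (bdecr k) _.
  by rewrite gerBl mulr_ge0.
have half : k./2 @[k --> \oo] --> \oo.
  apply/cvgnyPge => A; near=> k; rewrite geq_half_double.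
  by near: k; exact: nbhs_infty_ge.
apply: (squeeze_cvgr (f := fun=> 0) (h := fun k => b k./2 - b k)).
- apply: nearW => k; rewrite mulr_ge0//=.
  have hk : (k./2.*2 <= k)%N by rewrite -geq_half_double.
  have hk' : (k./2 <= k)%N by apply: leq_trans hk; rewrite -addnn leq_addr.
  (* The block from [k./2] to [k] has length at least half of [k], so the factor 2 restores the full
     factor [k]. *)
  have := blk k./2 (k - k./2)%N; rewrite subnKC//.
  apply: le_trans; rewrite mulrA ler_wpM2r// -natrM ler_nat.
  by rewrite muln2 doubleB -addnn -addnBA// leq_addr.
- exact: cvg_cst.
- rewrite -(subrr (limn b)); apply: cvgB; last exact: bcvg.
  exact: (@cvg_comp _ _ _ (fun k => k./2) b _ _ _ half bcvg).
Unshelve. all: by end_near.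
Qed.

(** * Expectations along an iteration driven by independent finite-valued indices *)

Section RandomIteration.
Variables (R : realType) (S : finType) (X : Type).
Variables (step : X -> S -> X) (p : S -> R).

Fixpoint driven_iter (x0 : X) (s : nat -> S) (k : nat) : X :=
  if k is k'.+1 then step (driven_iter x0 s k') (s k') else x0.

Definition transition (F : X -> R) (x : X) : R := \sum_j p j * F (step x j).

Lemma eq_driven_iter x0 s s' k : (forall l, (l < k)%N -> s l = s' l) ->
  driven_iter x0 s k = driven_iter x0 s' k.
Proof.
elim: k => //= k IH ss'; rewrite ss'// IH// => l lk.
by rewrite ss'// ltnS ltnW.
Qed.

Section Expectation.
Variables (d : measure_display) (T : measurableType d) (P : probability T R).
Variables (i : nat -> T -> S) (x0 : X).
Hypotheses (i_rv : forall k, finite_rv (i k)).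
Hypotheses (i_indep : mutually_independent P i).
Hypotheses (i_law : forall k j, P (i k @^-1` [set j]) = (p j)%:E).

Let x k w := driven_iter x0 (i^~ w) k.

(** The point [x k] is determined by finitely many indices with finitely many values, so [X] carries
    no sigma-algebra and [F] below may be any function. Splitting on the last index forces the
    induction to range over all [A]. *)
Lemma measurable_driven_iter k (A : set X) : measurable (x k @^-1` A).
Proof.
elim: k A => [|k IH] A.
  have [Ax0|Ax0] := pselect (A x0).
    rewrite (_ : _ @^-1` _ = setT) ?measurableT//.
    by apply/seteqP; split.
  rewrite (_ : _ @^-1` _ = set0) ?measurable0//.
  by apply/seteqP; split.
rewrite (_ : _ @^-1` _ = \bigcup_(j in [set: S])
    (i k @^-1` [set j] `&` x k @^-1` [set y | A (step y j)])).
  apply: fin_bigcup_measurable => // j _.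
  by apply: measurableI; [exact: i_rv | exact: IH].
apply/seteqP; split => w /=; first by move=> Aw; exists (i k w).
by case=> j _ /= [<-].
Qed.

Let cyl (s : nat -> S) m := [set w | forall l, (l < m)%N -> i l w = s l].

Let measurable_cyl s m : measurable (cyl s m).
Proof.
rewrite (_ : cyl s m = \bigcap_(l in `I_m) (i l @^-1` [set s l])).
  by apply: fin_bigcap_measurable => // l _; exact: i_rv.
by [].
Qed.

Let P_cyl s m : P (cyl s m) = (\prod_(l < m) p (s l))%:E.
Proof.
have J : perm_eq [fset l in iota 0 m]%fset (iota 0 m).
  by apply: uniq_perm (fset_uniq _) (iota_uniq _ _) _ => l; rewrite inE.
transitivity (P (\bigcap_(l in [set` [fset l in iota 0 m]%fset])
    (i l @^-1` [set s l]))).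
  congr (P _); apply/seteqP; split => w /= h l.
    by rewrite /= inE mem_iota; exact: h.
  by move=> lm; apply: h; rewrite /= inE mem_iota.
rewrite (i_indep _ (fun l => [set s l])) (perm_big _ J)/=.
under eq_bigr do rewrite i_law.
by rewrite prodEFin -[m in iota _ m]subn0 -/(index_iota 0 m) big_mkord.
Qed.

Let upd (s : nat -> S) m j l := if l == m then j else s l.

(* Conditioning on the first [m] indices and splitting on the next one. *)
Let integral_cyl k m s (F : X -> R) :
  (\int[P]_(w in cyl s m) (F (x (m + k) w))%:E =
   P (cyl s m) * (iter k transition F (driven_iter x0 s m))%:E)%E.
Proof.
elim: k m s => [|k IH] m s.
  rewrite addn0 muleC -integral_cst//; apply: eq_integral => w.
  by rewrite inE => h; rewrite /x (@eq_driven_iter _ _ s).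
have split_cyl : cyl s m =
    \big[setU/set0]_(j <- index_enum S) cyl (upd s m j) m.+1.
  rewrite -bigcup_seq; apply/seteqP; split => w /=.
    move=> h; exists (i m w); rewrite /= ?mem_index_enum// => l.
    by rewrite /upd ltnS leq_eqVlt; case: eqVneq => [->//|_]/=; exact: h.
  case=> j _ h l lm; have := h l; rewrite /upd ltnS ltnW// => /(_ isT) ->.
  by rewrite ltn_eqF.
rewrite split_cyl integral_bigsetU_EFin//=.
(* On the piece with next index [j] the fixed prefix moves on by [step _ j] and the probability
   gains the factor [p j]; summing over [j] gives one more application of [transition]. *)
- rewrite -split_cyl; under eq_bigr => j _.
    rewrite addnS -addSn IH P_cyl big_ord_recr/= -EFinM.
    rewrite (@eq_driven_iter _ (upd s m j) s); last first.
      by move=> l lm; rewrite /upd ltn_eqF.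
    rewrite {2 3}/upd eqxx.
    under eq_bigr => l _ do rewrite /upd ltn_eqF//.
    rewrite -mulrA; over.
  by rewrite sumEFin -mulr_sumr P_cyl -EFinM.
- exact: index_enum_uniq.
- move=> j j' _ _ [w [/= h h']].
  by have := h m (leqnn _); rewrite h'// /upd eqxx.
- rewrite -split_cyl.
  move=> _ B mB; apply: measurableI => //.
  exact: (measurable_driven_iter (m + k.+1) ((EFin \o F) @^-1` B)).
Qed.

Lemma expectation_driven_iter k (F : X -> R) :
  'E_P[fun w => F (x k w)]%E = (iter k transition F x0)%:E.
Proof.
(* The cylinder of length 0 is the whole space for any sequence; a sample point supplies one, since
   [S] is not assumed inhabited. *)
have [w0 _] : [set: T] !=set0 by exists point.
have := integral_cyl k 0 (i^~ w0) F; rewrite add0n.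
rewrite (_ : cyl _ 0 = setT); last by apply/seteqP; split.
by rewrite probability_setT mul1e unlock.
Qed.

End Expectation.

Section TransitionTheory.
Hypotheses (p_ge0 : forall j, 0 <= p j) (p_sum : \sum_j p j = 1).

Lemma le_transition F G : (forall x, F x <= G x) ->
  forall x, transition F x <= transition G x.
Proof. by move=> FG x; apply: ler_sum => j _; exact: ler_wpM2l. Qed.

Lemma le_iter_transition k F G : (forall x, F x <= G x) ->
  forall x, iter k transition F x <= iter k transition G x.
Proof. by move=> FG; elim: k => //= k IH; exact: le_transition. Qed.

(** [transition] is linear and fixes constants because the weights sum to 1. This lets a one-step
    bound that is affine in [F] and [G] be averaged over [k] steps. *)
Lemma iter_transition_affine k F G (b c : R) x :
  iter k transition (fun y => F y + b * G y + c) x =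
  iter k transition F x + b * iter k transition G x + c.
Proof.
elim: k x => //= k IH x; rewrite /transition.
under eq_bigr do rewrite IH !mulrDr mulrCA.
by rewrite !big_split/= -mulr_sumr -mulr_suml p_sum mul1r.
Qed.

Lemma iter_transition_ge k F (c : R) : (forall x, c <= F x) ->
  forall x, c <= iter k transition F x.
Proof.
move=> cF; elim: k => //= k IH x.
rewrite -[c]mul1r -p_sum mulr_suml; apply: ler_sum => j _.
exact: ler_wpM2l.
Qed.
End TransitionTheory.
End RandomIteration.

(** * Directional derivatives: tangent inequality and quadratic upper bound *)

Section Calculus.
Variables (R : realType) (V : normedModType R) (f : V -> R).

Lemma is_derive_line (x v : V) (s : R) :
  derivable (f : V -> R^o) (x + s *: v) v ->
  is_derive s 1 (fun t : R => f (x + t *: v) : R^o)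
    ('D_v (f : V -> R^o) (x + s *: v)).
Proof.
have E : (fun h : R => h^-1 *: ((f (x + (h *: (1 : R) + s) *: v) : R^o)
    - f (x + s *: v))) =
    (fun h : R => h^-1 *: ((f (h *: v + (x + s *: v)) : R^o) - f (x + s *: v))).
  apply/funext => h; congr (_ *: (f _ - _)).
  by rewrite [h *: 1]mulr1 scalerDl addrCA.
move=> df; split; first by rewrite /derivable/= E.
by rewrite /derive/= E.
Qed.

(** By convexity the slope of the chord from [x] towards [y] is at most [f y - f x] for steps [h] in
    (0, 1]; the bound survives the limit as [h] tends to 0 from the right. *)
Lemma convex_ge_tangent (x y : V) :
  convex_function (E := V) setT f ->
  derivable (f : V -> R^o) x (y - x) ->
  f x + 'D_(y - x) (f : V -> R^o) x <= f y.
Proof.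
move=> cf df; rewrite addrC -lerBrDr.
rewrite /derive; move: (df) => /cvg_ex[l dl]; rewrite (cvg_lim _ dl)//.
apply: (@cvgr_to_le _ _ _ _ _ _ _ (cvg_dnbhs_at_right dl)).
near=> h.
have h0 : 0 < h by near: h; exact: nbhs_right_gt.
have h1 : h <= 1 by near: h; apply: nbhs_right_le.
rewrite /GRing.scale/= ler_pdivrMl//.
have : f (h *: (y - x) + x) <= h * f y + (1 - h) * f x.
  rewrite (_ : _ + x = h *: y + (1 - h) *: x).
    exact: (cf (Itv01 (ltW h0) h1) y x (mem_setT _) (mem_setT _)).
  by rewrite scalerBl scale1r scalerBr addrA addrAC.
rewrite /GRing.scale/=; lra.
Unshelve. all: by end_near.
Qed.

Lemma lipschitz_derive_descent (x v : V) (L : R) :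
  (forall t : R, derivable (f : V -> R^o) (x + t *: v) v) ->
  (forall t : R, 0 <= t -> 'D_v (f : V -> R^o) (x + t *: v)
     <= 'D_v (f : V -> R^o) x + L * t) ->
  f (x + v) <= f x + 'D_v (f : V -> R^o) x + L / 2.
Proof.
move=> df dl.
(* Subtracting the linear and quadratic terms turns the claim into [g 1 <= g 0], which the mean
   value theorem gives since the derivative of [g] is nonpositive on [0, 1]. *)
pose g (t : R) : R := f (x + t *: v) - t * 'D_v (f : V -> R^o) x - L / 2 * t ^+ 2.
have dg (t : R) : is_derive t (1 : R) (g : R -> R^o)
    ('D_v (f : V -> R^o) (x + t *: v) - 'D_v (f : V -> R^o) x - L * t).
  have dft := is_derive_line (df t).
  have Eg : (g : R -> R^o) = (fun s : R => f (x + s *: v) : R^o)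
      - ('D_v (f : V -> R^o) x : R) \*: (id : R -> R^o)
      - (L / 2 : R) \*: ((id : R -> R^o) ^+ 2).
    by apply/funext => s; rewrite /g/= mulrC.
  rewrite Eg; apply: is_derive_eq.
  by rewrite /GRing.scale/= expr1 !mulr1 mulrA divfK.
have gc : {within `[0, 1], continuous g}.
  apply: derivable_within_continuous => t _; by case: (dg t).
have [t t01] := MVT_segment ler01 (fun t _ => dg t) gc.
rewrite subr0 mulr1 /g scale0r scale1r addr0 !mul0r mul1r expr0n/= expr1n.
have := dl t; move: t01; rewrite in_itv/= => /andP[-> _] /(_ isT).
lra.
Qed.
End Calculus.

(** * Decrease of the objective in one coordinate step *)

Section CoordinateDescent.
Variables (R : realType) (n : nat) (f : 'rV[R]_n -> R).
Hypothesis f_diff : forall x, differentiable (f : 'rV[R]_n -> R^o) x.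

Lemma derive_gradient (x v : 'rV[R]_n) :
  'D_v (f : 'rV[R]_n -> R^o) x = \sum_j v 0 j * gradient f x 0 j.
Proof.
rewrite deriveE// [in LHS](row_sum_delta v) linear_sum/=.
by apply: eq_bigr => j _; rewrite linearZ/= mxE deriveE.
Qed.

Lemma derive_unit_vec (x : 'rV[R]_n) (h : R) j :
  'D_(h *: unit_vec R j) (f : 'rV[R]_n -> R^o) x = h * gradient f x 0 j.
Proof. by rewrite deriveE// linearZ/= mxE deriveE. Qed.

Definition coord_step (Lbar : 'I_n -> R) (x : 'rV[R]_n) (j : 'I_n) :=
  x - (gradient f x 0 j / Lbar j) *: unit_vec R j.

Lemma coord_stepE Lbar x j l : coord_step Lbar x j 0 l =
  x 0 l - (gradient f x 0 j / Lbar j) *+ (l == j).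
Proof. by rewrite !mxE eqxx/= mulr_natr. Qed.

(** The step minimizes the quadratic model of [f] along [unit_vec R j] with curvature [Lbar j],
    which majorizes [f] on that line; the bound is the minimum of the model. *)
Lemma coord_step_descent (L Lbar : 'I_n -> R) (j : 'I_n) x :
  0 < L j -> L j <= Lbar j ->
  (forall (x : 'rV[R]_n) (h : R),
    `|gradient f x 0 j - gradient f (x + h *: unit_vec R j) 0 j| <= L j * `|h|) ->
  f (coord_step Lbar x j) <= f x - gradient f x 0 j ^+ 2 / Lbar j / 2.
Proof.
move=> L0 LLbar lip; have Lb0 := lt_le_trans L0 LLbar.
set g := gradient f x 0 j; set h := - (g / Lbar j).
have gE : g = - (h * Lbar j) by rewrite /h mulNr opprK divfK// gt_eqF.
have -> : g ^+ 2 / Lbar j = h ^+ 2 * Lbar j.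
  by rewrite gE; field; rewrite gt_eqF.
rewrite /coord_step -scaleNr -/g -/h.
(* In the direction [h *: unit_vec R j] one factor [h] comes from the derivative and one from the
   displacement, hence the constant [h ^+ 2 * L j]. *)
apply: le_trans (lipschitz_derive_descent (L := h ^+ 2 * L j) _ _) _.
- by move=> t; exact: diff_derivable.
- move=> t t0; rewrite !derive_unit_vec scalerA -/g -lerBlDl -mulrBr.
  rewrite (le_trans (ler_norm _))// normrM distrC.
  rewrite (le_trans (ler_wpM2l (normr_ge0 _) (lip _ _)))// normrM (ger0_norm t0).
  by rewrite -(real_normK (num_real h)) le_eqVlt; apply/orP; left; apply/eqP; ring.
- rewrite derive_unit_vec -/g gE.
  have := ler_wpM2l (sqr_ge0 h) LLbar; lra.
Qed.

End CoordinateDescent.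

Lemma coord_descentE (R : realType) (n : nat) (f : 'rV[R]_n -> R) Lbar x0 s k :
  coord_descent f Lbar x0 s k = driven_iter (coord_step f Lbar) x0 s k.
Proof. by elim: k => //= k ->. Qed.

(** * Expected decrease of the Lyapunov function *)

Section Lyapunov.
Variables (R : realType) (n : nat) (f : 'rV[R]_n -> R).
Variables (L Lbar p : 'I_n -> R) (pmin : R) (xs : 'rV[R]_n).
Hypothesis f_convex : convex_function (E := 'rV[R]_n) [set: 'rV[R]_n] f.
Hypothesis f_diff : forall x, differentiable (f : 'rV[R]_n -> R^o) x.
Hypothesis L_gt0 : forall j, 0 < L j.
Hypothesis grad_lip : forall j x h,
  `|gradient f x 0 j - gradient f (x + h *: unit_vec R j) 0 j| <= L j * `|h|.
Hypothesis Lbar_ge : forall j, L j <= Lbar j.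
Hypothesis p_sum : \sum_(j < n) p j = 1.
Hypothesis pmin_gt0 : 0 < pmin.
Hypothesis p_ge : forall j, pmin <= p j.

Let Lbar_gt0 j : 0 < Lbar j. Proof. exact: lt_le_trans (Lbar_ge j). Qed.
Let p_gt0 j : 0 < p j. Proof. exact: lt_le_trans (p_ge j). Qed.

Let descent x j :=
  coord_step_descent f_diff x (L_gt0 j) (Lbar_ge j) (grad_lip j).

Lemma transition_coord_step_le x : transition (coord_step f Lbar) p f x <= f x.
Proof.
rewrite -[leRHS]mul1r -p_sum mulr_suml; apply: ler_sum => j _.
apply: ler_wpM2l; first exact: ltW.
apply: le_trans (descent x j) _.
by rewrite gerBl !divr_ge0// ?sqr_ge0// ltW.
Qed.

Definition wdist (x : 'rV[R]_n) := \sum_j Lbar j / p j * (x 0 j - xs 0 j) ^+ 2.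

Definition lyapunov x := wdist x + 2 / pmin * (f x - f xs).

(* The weight [Lbar j / p j] cancels both the probability and the step size,
   leaving the [j]th term of the inner product with the gradient. *)
Lemma wdist_coord_step x j :
  p j * wdist (coord_step f Lbar x j) = p j * wdist x
    - 2 * gradient f x 0 j * (x 0 j - xs 0 j) + gradient f x 0 j ^+ 2 / Lbar j.
Proof.
rewrite /wdist (bigD1 j)//= [in RHS](bigD1 j)//= coord_stepE eqxx mulr1n.
under eq_bigr => l lj do rewrite coord_stepE (negbTE lj) mulr0n subr0.
by field; rewrite !gt_eqF.
Qed.

Lemma transition_lyapunov x :
  transition (coord_step f Lbar) p lyapunov x
    <= lyapunov x - 2 * (f x - f xs).
Proof.
have tangent : \sum_j (xs 0 j - x 0 j) * gradient f x 0 j <= f xs - f x.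
  rewrite lerBrDl.
  have := convex_ge_tangent f_convex (diff_derivable (v := xs - x) (f_diff x)).
  rewrite derive_gradient//; congr (_ + _ <= _).
  by apply: eq_bigr => j _; rewrite !mxE.
(* Convexity is needed only for the whole inner product; with the sum kept here, the remaining
   inequality holds separately for each [j]. *)
apply: (@le_trans _ _ (lyapunov x +
    2 * \sum_j (xs 0 j - x 0 j) * gradient f x 0 j)); last first.
  by rewrite lerD2l; move: tangent; lra.
have {1}-> : lyapunov x = \sum_j p j * lyapunov x.
  by rewrite -mulr_suml p_sum mul1r.
rewrite mulr_sumr -big_split/=.
apply: ler_sum => j _; rewrite /lyapunov mulrDr wdist_coord_step.
set g := gradient f x 0 j; set y := coord_step f Lbar x j.
have G0 : 0 <= g ^+ 2 / Lbar j by rewrite divr_ge0 ?sqr_ge0 ?ltW.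
have : p j * (2 / pmin) * f y <= p j * (2 / pmin) * (f x - g ^+ 2 / Lbar j / 2).
  by rewrite ler_wpM2l ?descent// mulr_ge0 ?divr_ge0 ?ltW.
(* The weight [2 / pmin] is chosen for this: the descent of [f], weighted by [p j], covers the
   second-order term of [wdist] since [p j / pmin] is at least 1. *)
have : g ^+ 2 / Lbar j <= p j / pmin * (g ^+ 2 / Lbar j).
  by rewrite ler_peMl// ler_pdivlMr// mul1r.
lra.
Qed.

Lemma lyapunov_ge0 x : f xs <= f x -> 0 <= lyapunov x.
Proof.
move=> fx; apply: addr_ge0.
  by apply: sumr_ge0 => j _; rewrite mulr_ge0 ?sqr_ge0// divr_ge0// ltW.
by rewrite mulr_ge0 ?subr_ge0// divr_ge0// ltW.
Qed.

End Lyapunov.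

(** * The convergence rate *)

Theorem theorem3 (R : realType) (n : nat) (f : 'rV[R]_n -> R) (fstar : R)
  (L Lbar p : 'I_n -> R) (pmin : R) (x0 : 'rV[R]_n)
  (d : measure_display) (T : measurableType d) (P : probability T R)
  (i : nat -> T -> 'I_n)
  (f_convex : convex_function (E := 'rV[R]_n) [set: 'rV[R]_n] f)
  (f_diff : forall x : 'rV[R]_n, differentiable (f : 'rV[R]_n -> R^o) x)
  (argmin_nonempty : argmin f !=set0)
  (fstar_min : is_min_value f fstar)
  (L_gt0 : forall j : 'I_n, 0 < L j)
  (grad_lip : forall (j : 'I_n) (x : 'rV[R]_n) (h : R),
    `|gradient f x 0 j - gradient f (x + h *: unit_vec R j) 0 j| <= L j * `|h|)
  (Lbar_ge : forall j : 'I_n, L j <= Lbar j)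
  (p_sum : \sum_(j < n) p j = 1)
  (pmin_gt0 : 0 < pmin)
  (p_ge : forall j : 'I_n, pmin <= p j)
  (i_rv : forall k : nat, finite_rv (i k))
  (i_indep : mutually_independent P i)
  (i_law : forall (k : nat) (j : 'I_n), P (i k @^-1` [set j]) = (p j)%:E) :
  (k%:R%:E *
    ('E_P[fun w => f (coord_descent f Lbar x0 (fun l => i l w) k)] - fstar%:E))%E
    @[k --> \oo] --> 0%E.
Proof.
have [xs xs_min] := argmin_nonempty.
have fstarE : fstar = f xs.
  have [[y _ <-] lb] := fstar_min; apply/eqP; rewrite eq_le xs_min andbT.
  by apply: lb; exists xs.
have p_ge0 j : 0 <= p j by apply: le_trans (p_ge j); exact: ltW.
pose Q := transition (coord_step f Lbar) p.
pose a k := iter k Q f x0 - f xs.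
pose Phi := lyapunov f Lbar p pmin xs.
have Ef k : 'E_P[fun w => f (coord_descent f Lbar x0 (fun l => i l w) k)]%E =
    (iter k Q f x0)%:E.
  rewrite -(expectation_driven_iter (coord_step f Lbar) x0 i_rv i_indep i_law).
  by congr expectation; apply/funext => w; rewrite coord_descentE.
rewrite (_ : (fun k : nat => _) = (fun k => (k%:R * a k)%:E)); last first.
  by apply/funext => k; rewrite Ef fstarE -EFinB -EFinM.
apply: cvg_EFin; first by near=> k.
apply: (@telescoping_rate _ a (fun k => iter k Q Phi x0)).
- by move=> k; rewrite subr_ge0; exact: iter_transition_ge.
(* Peeling off the innermost application compares [Q f] with [f] pointwise, and the monotone iterate
   preserves the comparison. *)
- move=> k; rewrite lerD2r iterSr; apply: le_iter_transition => // x.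
  exact: (transition_coord_step_le f_diff L_gt0 grad_lip Lbar_ge p_sum pmin_gt0 p_ge).
- move=> k; apply: iter_transition_ge => // x.
  exact: (lyapunov_ge0 L_gt0 Lbar_ge pmin_gt0 p_ge (xs_min x)).
- move=> k.
  (* Written this way, the right side is the [k]-fold average of [Phi - 2 (f - f xs)], so the
     one-step Lyapunov bound applies under the iterate. *)
  have -> : iter k Q Phi x0 - 2 * a k =
      iter k Q Phi x0 + (- 2) * iter k Q f x0 + 2 * f xs by rewrite /a; ring.
  rewrite -iter_transition_affine// iterSr; apply: le_iter_transition => // x.
  have := transition_lyapunov xs f_convex f_diff L_gt0 grad_lip Lbar_ge p_sum
    pmin_gt0 p_ge x.
  rewrite -/Q -/Phi; lra.
Unshelve. all: by end_near.
Qed.
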